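(* Let $\mathcal{C}_H(\mathcal{P},m)$ be a maximal semi-grid $C_{ab}$ code of length $n$ over a finite field $\mathbb{F}$. Then encoding using the algorithm $\mathsf{Encode}$ described in the context has complexity $O(\mathsf{M}(n)\log(n))\subset\tilde{O}(n)$ operations in $\mathbb{F}$.
   Context: Codes. Let $\mathbb{F}$ be a finite field and $a,b$ coprime positive integers, not both $1$. Let $\operatorname{supp}(H)$ be the set of monomials with non-zero coefficient in $H$. $H\in\mathbb{F}[X,Y]$ is a $C_{ab}$ polynomial if: (i) $X^b,Y^a\in\operatorname{supp}(H)$; (ii) $X^iY^j\in\operatorname{supp}(H)$ implies $ai+bj\le ab$; (iii) $\langle H,\partial H/\partial X,\partial H/\partial Y\rangle=\mathbb{F}[X,Y]$. Its function field $\mathbb{F}(x,y)$, with $H(x,y)=0$, has a rational place $P_\infty$ that is the only pole of $x$ and of $y$; $x^iy^j$ has pole order $ai+bj$ there. The other rational places (finite rational places) are identified with the points $(\alpha,\beta)\in\mathbb{F}^2$ with $H(\alpha,\beta)=0$. Each $f\in\mathbb{F}[x,y]$ has a unique expression with $y$-degree at most $a-1$, its standard form. The Riemann–Roch space $\mathcal{L}(mP_\infty)$ has basis $B=\{x^iy^j\mid ai+bj\le m,\ j\le a-1\}$. For a set $\mathcal{P}=\{P_1,\dots,P_n\}$ of distinct finite rational places and an integer $m\ge0$, $\mathcal{C}_H(\mathcal{P},m)=\{\operatorname{ev}_{\mathcal{P}}(f)\mid f\in\mathcal{L}(mP_\infty)\}$ with $\operatorname{ev}_{\mathcal{P}}(f)=(f(P_1),\dots,f(P_n))$.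 Point sets. For $\mathcal{P}\subseteq\mathbb{F}^2$, $\mathcal{X}(\mathcal{P})$ is the set of $X$-coordinates of points of $\mathcal{P}$, $\mathcal{Y}_\alpha(\mathcal{P})=\{\beta\in\mathbb{F}\mid(\alpha,\beta)\in\mathcal{P}\}$ and $\nu_Y(\mathcal{P})=\max_{\alpha\in\mathcal{X}(\mathcal{P})}|\mathcal{Y}_\alpha(\mathcal{P})|$. $\mathcal{P}$ is a semi-grid if $|\mathcal{Y}_\alpha(\mathcal{P})|\in\{0,\nu_Y(\mathcal{P})\}$ for each $\alpha\in\mathbb{F}$. The code $\mathcal{C}_H(\mathcal{P},m)$ is maximal semi-grid if $\mathcal{P}$ is a semi-grid with $\nu_Y(\mathcal{P})=a=\deg_Y(H)$ and $m<n$. Encoding map. Since $m<n$, $\operatorname{ev}_{\mathcal{P}}$ is injective on $\mathcal{L}(mP_\infty)$ and the dimension of the code is $k=|B|$. The encoding map is $\phi=\operatorname{ev}_{\mathcal{P}}\circ\varphi:\mathbb{F}^k\to\mathcal{C}_H(\mathcal{P},m)$, where $\varphi:\mathbb{F}^k\to\mathcal{L}(mP_\infty)$ takes the entries of the message as coefficients of the monomials of $B$ in some specified order. Subroutine $\mathsf{UnivariateMPE}$: the classical fast multipoint evaluation algorithm; it inputs $h\in\mathbb{F}[Z]$ and $\mathcal{S}\subseteq\mathbb{F}$ and outputs the table $(h(\alpha))_{\alpha\in\mathcal{S}}$ in $O\big(\mathsf{M}(\deg h+|\mathcal{S}|)\log(\deg h+|\mathcal{S}|)\big)$ operations. Subroutine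 $\mathsf{BivariateMPE}(f,\mathcal{P})$, for $f=\sum_{i=0}^{d_Y}f_i(X)Y^i\in\mathbb{F}[X,Y]$: compute $\mathcal{X}=\mathcal{X}(\mathcal{P})$ and $\mathcal{Y}_\alpha=\mathcal{Y}_\alpha(\mathcal{P})$; for $i=0,\dots,d_Y$ compute $\mathcal{F}_i=\mathsf{UnivariateMPE}(f_i,\mathcal{X})$; for each $\alpha\in\mathcal{X}$ form $g_\alpha=\sum_{i=0}^{d_Y}\mathcal{F}_i[\alpha]Y^i$ and compute $\mathcal{G}_\alpha=\mathsf{UnivariateMPE}(g_\alpha,\mathcal{Y}_\alpha)$; return $(\mathcal{G}_\alpha[\beta])_{(\alpha,\beta)\in\mathcal{P}}$. Algorithm $\mathsf{Encode}$. Input: $\mathcal{C}_H(\mathcal{P},m)$ and a message $\mathbf{m}\in\mathbb{F}^k$. Output: $\phi(\mathbf{m})$. 1. $f\leftarrow\varphi(\mathbf{m})\in\mathbb{F}[x,y]$ in standard form. 2. $\mathcal{F}\leftarrow\mathsf{BivariateMPE}(f,\mathcal{P})\in\mathbb{F}^{\mathcal{P}}$, where $f$ is lifted to $\mathbb{F}[X,Y]$ via its standard form. 3. Return $(\mathcal{F}[P_1],\dots,\mathcal{F}[P_n])\in\mathbb{F}^n$. Complexity counts basic arithmetic operations in $\mathbb{F}$ on an algebraic RAM model (table retrieval and insertion cost $O(1)$). $\mathsf{M}(n)$ is the cost of multiplying two univariate polynomials in $\mathbb{F}[X]$ of degree at most $n$; one can take $\mathsf{M}(n)\in O(n\log n\log\log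 n)\subset\tilde{O}(n)$. Here $\tilde{O}(h)=\bigcup_{c\ge0}O(h\log^c h)$.
   Formalization: The multiplication cost M is additionally assumed positive and superadditive (M(s)+M(t) ≤ M(s+t)) with M(2n) = O(M(n)), the usual regularity convention; for irregular cost functions M the bound O(M(n) log n) can fail. *)

(* Defs.v *)
From HB Require Import structures.
From mathcomp Require Import all_boot all_order all_algebra.
From mathcomp Require Import all_classical all_reals all_analysis.

Set Implicit Arguments.
Unset Strict Implicit.
Unset Printing Implicit Defensive.

Import Order.TTheory GRing.Theory Num.Theory.
Import numFieldNormedType.Exports.
Local Open Scope ring_scope.

(* F[X,Y] is {poly {poly F}}, polynomials in Y over F[X]: the coefficient of
   X^i Y^j in H is H`_j`_i, and deg_Y H = (size H).-1. *)
Definition in_supp (F : fieldType) (H : {poly {poly F}}) (i j : nat) : Prop :=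
  H`_j`_i != 0.

Definition dX (F : fieldType) (H : {poly {poly F}}) : {poly {poly F}} :=
  map_poly (fun c : {poly F} => c^`()) H.

Definition dY (F : fieldType) (H : {poly {poly F}}) : {poly {poly F}} := H^`().

Definition eval2 (F K : fieldType) (iota : F -> K) (p : {poly {poly F}})
    (x y : K) : K :=
  (map_poly (fun c : {poly F} => (map_poly iota c).[x]) p).[y].

Definition is_Cab (F : fieldType) (a b : nat) (H : {poly {poly F}}) : Prop :=
  [/\ [/\ (0 < a)%N, (0 < b)%N, coprime a b & ~ (a = 1%N /\ b = 1%N)],
      in_supp H b 0 /\ in_supp H 0 a,
      forall i j, in_supp H i j -> (a * i + b * j <= a * b)%N
    & forall g : {poly {poly F}},
        exists u v w, g = u * H + v * dX H + w * dY H].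

(* The fraction field of F[X,Y]/(H), characterized by its generators x, y. *)
Record function_field (F : fieldType) (H : {poly {poly F}}) := FunctionField {
  ff_sort :> fieldType;
  ff_const : {rmorphism F -> ff_sort};
  ff_x : ff_sort;
  ff_y : ff_sort;
  ff_relP : forall p, eval2 ff_const p ff_x ff_y = 0 <-> exists q, p = q * H;
  ff_genP : forall z : ff_sort, exists p q,
    eval2 ff_const q ff_x ff_y != 0 /\
    z = eval2 ff_const p ff_x ff_y / eval2 ff_const q ff_x ff_y
}.

Section Places.
Variables (F : fieldType) (H : {poly {poly F}}) (K : function_field H).

(* A place is represented by its normalized discrete valuation; the integer
   place_val 0 carries no information (the valuation of 0 is +oo). *)
Record place := Place {
  place_val :> K -> int;
  place_valM : forall z w, z != 0 -> w != 0 ->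
    place_val (z * w) = place_val z + place_val w;
  place_valD : forall z w, z != 0 -> w != 0 -> z + w != 0 ->
    Num.min (place_val z) (place_val w) <= place_val (z + w);
  place_valC : forall c, c != 0 -> place_val (ff_const K c) = 0;
  place_val1 : exists z, z != 0 /\ place_val z = 1
}.

Definition same_place (v w : place) : Prop := forall z, z != 0 -> v z = w z.

Definition is_pole (v : place) (z : K) : Prop := z != 0 /\ v z < 0.

(* f(P) = c, i.e. f - c lies in the maximal ideal of P. *)
Definition has_value (v : place) (f : K) (c : F) : Prop :=
  f - ff_const K c != 0 -> 0 < v (f - ff_const K c).

Definition rational_place (v : place) : Prop :=
  forall z, ~ is_pole v z -> exists c, has_value v z c.

Definition is_Pinf (a b : nat) (v : place) : Prop :=
  [/\ rational_place v,
      forall w, is_pole w (ff_x K) <-> same_place w v,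
      forall w, is_pole w (ff_y K) <-> same_place w v
    & forall i j, - v (ff_x K ^+ i * ff_y K ^+ j) = (a * i + b * j)%:Z].

Definition RR_space (Pinf : place) (m : nat) (f : K) : Prop :=
  f != 0 -> - m%:Z <= Pinf f /\
    forall w, ~ same_place w Pinf -> 0 <= w f.

(* The finite rational place identified with the point p. *)
Definition place_at (Pinf v : place) (p : F * F) : Prop :=
  [/\ rational_place v, ~ same_place v Pinf,
      has_value v (ff_x K) p.1 & has_value v (ff_y K) p.2].

End Places.

(* The data (H, {P_1, ..., P_n}, m) defining C_H(P, m); code_pts lists the
   points identified with the places P_i = code_place (nth _ code_pts i). *)
Record cab_code (F : finFieldType) := CabCode {
  code_a : nat;
  code_b : nat;
  code_H : {poly {poly F}};
  code_Cab : is_Cab code_a code_b code_H;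
  code_ff : function_field code_H;
  code_Pinf : place code_ff;
  code_PinfP : is_Pinf code_a code_b code_Pinf;
  code_pts : seq (F * F);
  code_uniq : uniq code_pts;
  code_on_curve : forall p, p \in code_pts -> code_H.[(p.2)%:P].[p.1] = 0;
  code_place : F * F -> place code_ff;
  code_placeP : forall p, p \in code_pts ->
    place_at code_Pinf (code_place p) p;
  code_m : nat
}.

Definition code_length (F : finFieldType) (C : cab_code F) : nat :=
  size (code_pts C).

Definition is_ev (F : finFieldType) (C : cab_code F) (f : code_ff C)
    (c : seq F) : Prop :=
  size c = code_length C /\
  forall i, (i < code_length C)%N ->
    has_value (code_place C (nth (0, 0) (code_pts C) i)) f (nth 0 c i).

Definition codeword (F : finFieldType) (C : cab_code F) (c : seq F) : Prop :=
  exists2 f : code_ff C, RR_space (code_Pinf C) (code_m C) f & is_ev f c.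

Section PointSets.
Variables (F : finFieldType) (P : seq (F * F)).

Definition Xset : {set F} := [set p.1 | p in P]%SET.
Definition Yset (alpha : F) : {set F} := [set beta | (alpha, beta) \in P]%SET.
Definition nuY : nat := (\max_(alpha in Xset) #|Yset alpha|)%N.
Definition semi_grid : Prop :=
  forall alpha, #|Yset alpha| = 0%N \/ #|Yset alpha| = nuY.

End PointSets.

Definition maximal_semi_grid (F : finFieldType) (C : cab_code F) : Prop :=
  [/\ semi_grid (code_pts C), nuY (code_pts C) = code_a C
    & (code_m C < code_length C)%N].

(* B lists, in some order, the exponents (i, j) of the monomials x^i y^j of the
   basis of L(m P_oo). *)
Definition ordered_basis (F : finFieldType) (C : cab_code F)
    (B : seq (nat * nat)) : Prop :=
  uniq B /\ forall i j, ((i, j) \in B) =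
    ((code_a C * i + code_b C * j <= code_m C)%N && (j <= (code_a C).-1)%N).

Definition varphi (F : finFieldType) (C : cab_code F) (B : seq (nat * nat))
    (msg : (size B).-tuple F) : code_ff C :=
  \sum_(l < size B)
    ff_const (code_ff C) (tnth msg l)
      * ff_x (code_ff C) ^+ (nth (0%N, 0%N) B l).1
      * ff_y (code_ff C) ^+ (nth (0%N, 0%N) B l).2.

Definition table (K : eqType) (A : Type) := K -> option A.
Definition empty_table (K : eqType) (A : Type) : table K A := fun=> None.

(* Each arithmetic operation or test on field elements and each retrieval from
   or insertion into a table or list is one instruction of cost 1.  Field
   elements must be stored and moved by instructions; what is computed outside
   of them is control flow and the arithmetic of exponents and indices. *)
Inductive prog (F : Type) : Type -> Type :=
| Ret (A : Type) of A : prog F A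
| Bind (A B : Type) of prog F A & (A -> prog F B) : prog F B
| Add of F & F : prog F F
| Sub of F & F : prog F F
| Mul of F & F : prog F F
| Div of F & F : prog F F
| Eqt of F & F : prog F bool
| Lookup (K : eqType) (A : Type) of table K A & K : prog F (option A)
| Insert (K : eqType) (A : Type) of table K A & K & A : prog F (table K A)
| Push (A : Type) of A & seq A : prog F (seq A).

Arguments Ret {F A}.
Arguments Bind {F A B}.
Arguments Lookup {F K A}.
Arguments Insert {F K A}.
Arguments Push {F A}.

Declare Scope prog_scope.
Delimit Scope prog_scope with prog.
Notation "'let*' x ':=' p 'in' q" := (Bind p (fun x => q))
  (at level 200, x name, p at level 100, q at level 200, right associativity)
  : prog_scope.

Fixpoint result (F : fieldType) (A : Type) (p : prog F A) : A :=
  match p in prog _ A return A with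
  | Ret _ a => a
  | Bind _ _ p k => result (k (result p))
  | Add x y => x + y
  | Sub x y => x - y
  | Mul x y => x * y
  | Div x y => x / y
  | Eqt x y => x == y
  | Lookup _ _ t k => t k
  | Insert _ _ t k a => fun k' => if k' == k then Some a else t k'
  | Push _ a s => a :: s
  end.

Fixpoint cost (F : fieldType) (A : Type) (p : prog F A) : nat :=
  match p with
  | Ret _ _ => 0
  | Bind _ _ p k => cost p + cost (k (result p))
  | _ => 1
  end.

Section Loops.
Variable F : Type.
Local Open Scope prog_scope.

Fixpoint map_prog (A B : Type) (f : A -> prog F B) (s : seq A) :
    prog F (seq B) :=
  if s is x :: s' then
    let* y := f x in
    let* ys := map_prog f s' in
    Push y ys
  else Ret [::].

Fixpoint fold_prog (A S : Type) (f : S -> A -> prog F S) (st : S) (s : seq A) :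
    prog F S :=
  if s is x :: s' then
    let* st' := f st x in
    fold_prog f st' s'
  else Ret st.

End Loops.

Definition mpe_type :=
  forall F : finFieldType, {poly F} -> seq F -> prog F (table F F).

Section Encode.
Variables (UnivariateMPE : mpe_type) (F : finFieldType).
Local Open Scope prog_scope.

Definition get_or0 (K : eqType) (t : table K F) (k : K) : prog F F :=
  let* o := Lookup t k in Ret (odflt 0 o).

(* The list X(P) and the table of the lists Y_alpha(P). *)
Definition split_points (P : seq (F * F)) :
    prog F (seq F * table F (seq F)) :=
  fold_prog (fun (st : seq F * table F (seq F)) (p : F * F) =>
      let* o := Lookup st.2 p.1 in
      match o with
      | Some ys =>
          let* ys' := Push p.2 ys in
          let* T := Insert st.2 p.1 ys' in
          Ret (st.1, T)
      | None =>
          let* ys' := Push p.2 [::] in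
          let* T := Insert st.2 p.1 ys' in
          let* xs := Push p.1 st.1 in
          Ret (xs, T)
      end)
    ([::], @empty_table F (seq F)) P.

Definition BivariateMPE (f : {poly {poly F}}) (P : seq (F * F)) :
    prog F (table (F * F)%type F) :=
  let* XY := split_points P in
  let* Fs := map_prog (fun i => UnivariateMPE f`_i XY.1) (iota 0 (size f)) in
  let* G := fold_prog (fun (G : table F (table F F)) (alpha : F) =>
        let* cs := map_prog (fun Fi : table F F => get_or0 Fi alpha) Fs in
        let* ys := Lookup XY.2 alpha in
        let* Ga := UnivariateMPE (Poly cs) (odflt [::] ys) in
        Insert G alpha Ga)
      (@empty_table F (table F F)) XY.1 in
  fold_prog (fun (R : table (F * F)%type F) (p : F * F) =>
      let* Ga := Lookup G p.1 in
      let* v := get_or0 (odflt (@empty_table F F) Ga) p.2 in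
      Insert R p v)
    (@empty_table (F * F)%type F) P.

(* Step 1: the message is stored as the coefficients of the monomials of B, and
   the dense coefficients of the standard form are read off; an X-degree is at
   most m %/ a. *)
Definition standard_form (a m : nat) (B : seq (nat * nat)) (msg : seq F) :
    prog F {poly {poly F}} :=
  let* T := fold_prog (fun (T : table (nat * nat)%type F) (l : nat) =>
        let* c := get_or0 (onth msg : table nat F) l in
        Insert T (nth (0%N, 0%N) B l) c)
      (@empty_table (nat * nat)%type F) (iota 0 (size B)) in
  let* rows := map_prog (fun j =>
        let* cs := map_prog (fun i => get_or0 T (i, j)) (iota 0 (m %/ a).+1) in
        Ret (Poly cs))
      (iota 0 a) in
  Ret (Poly rows).

Definition Encode (C : cab_code F) (B : seq (nat * nat)) (msg : seq F) :
    prog F (seq F) :=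
  let* f := standard_form (code_a C) (code_m C) B msg in
  let* R := BivariateMPE f (code_pts C) in
  map_prog (fun p => get_or0 R p) (code_pts C).

End Encode.

(* M is a multiplication time with the usual regularity conventions: it is
   positive and superadditive, and M(2n) = O(M(n)). *)
Definition multiplication_time
    (PolyMul : forall F : finFieldType,
       {poly F} -> {poly F} -> prog F {poly F})
    (M : nat -> nat) : Prop :=
  [/\ forall (F : finFieldType) (n : nat) (p q : {poly F}),
        (size p <= n.+1)%N -> (size q <= n.+1)%N ->
        result (PolyMul F p q) = p * q /\ (cost (PolyMul F p q) <= M n)%N,
      forall n, (0 < n)%N -> (0 < M n)%N,
      forall s t, (0 < s)%N -> (0 < t)%N -> (M s + M t <= M (s + t))%N
    & exists D, forall n, (0 < n)%N -> (M (2 * n) <= D * M n)%N].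

Definition MlogO (R : realType) (M : nat -> nat) : set (nat -> R) :=
  [set f : nat -> R |
    f =O_\oo (fun n : nat => (M n)%:R * ln (n%:R : R) : R)]%classic.

Definition softO (R : realType) (h : nat -> R) : set (nat -> R) :=
  [set f : nat -> R | exists c : nat,
    f =O_\oo (fun n : nat => h n * ln (h n) ^+ c : R)]%classic.

(* The O-constant is uniform in the field: the size alone bounds the cost. *)
Definition fast_mpe (R : realType) (M : nat -> nat) (U : mpe_type) : Prop :=
  (forall (F : finFieldType) (h : {poly F}) (S : seq F), uniq S ->
     forall alpha, alpha \in S ->
       result (U F h S) alpha = Some h.[alpha]) /\
  exists2 T : nat -> R, MlogO M T &
    forall (F : finFieldType) (h : {poly F}) (S : seq F), uniq S ->
      (cost (U F h S))%:R <= T ((size h).-1 + size S)%N.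

(* Main.v *)
Require Import Defs.
From mathcomp Require Import all_boot all_order all_algebra.
From mathcomp Require Import all_classical all_reals all_analysis.
From mathcomp Require Import zify ring lra.
Import Order.TTheory GRing.Theory Num.Theory.
Import numFieldNormedType.Exports.
Local Open Scope classical_set_scope.
Local Open Scope ring_scope.

(** Correctness.  Taking values at a place is compatible with sums and products
    (the elements of non-negative valuation form a ring in which those of
    positive valuation form an ideal), so the value at the place of (x, y) of
    the function spelled by the message is the value at (x, y) of the
    polynomial with the same coefficients ([varphi_value]).  The algorithm
    computes the latter: the standard form carries the message coefficients
    ([standard_form_eval]), and evaluating first in X, then in Y along each
    fibre, evaluates the polynomial ([BivariateMPE_correct]).  The result is a
    codeword because every monomial of the basis has pole order at most m at
    the place at infinity and no other pole ([varphi_RR]).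

    Complexity.  Let s be the number of abscissas.  In a maximal semi-grid every
    fibre has exactly a points, so n = a * s.  As m < n, the X-degrees of the
    standard form are at most m / a < s, and its Y-degree is less than a.  Hence
    each univariate evaluation is balanced, its polynomial having degree less
    than its number of points: there are at most a of them on s points and s of
    them on a points.  One evaluation on s points costs O(M(2s) log(2s)), where
    M(2s) = O(M(s)), and superadditivity gives a * M(s) <= M(a * s) = M(n); the
    same holds with a and s exchanged.  So both rounds cost O(M(n) log n).  All
    loops around them have total length O(n) ([cost_Encode]), and n <= M(n).

    Substituting M(n) = O(n log n log log n) turns M(n) log n into
    O(n log^3 n), because log log n <= log n ([MlogO_softO]). *)

Set Implicit Arguments.
Unset Strict Implicit.
Unset Printing Implicit Defensive.

(** * Values at a place *)

Section Values.
Variables (F : finFieldType) (H : {poly {poly F}}) (K : function_field H).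
Variable v : place K.

(** Vacuous at 0, whose valuation stands for infinity. *)
Definition val_ge (k : int) (z : K) : Prop := z != 0 -> k <= v z.

Lemma val1 : v 1 = 0.
Proof.
have h := place_valM v (oner_neq0 K) (oner_neq0 K).
by apply: (addrI (v 1)); rewrite -h mulr1 addr0.
Qed.

Lemma val_ge0 k : val_ge k 0.
Proof. by rewrite /val_ge eqxx. Qed.

Lemma val_geD k z w : val_ge k z -> val_ge k w -> val_ge k (z + w).
Proof.
have [-> _|z0] := eqVneq z 0; first by rewrite add0r.
have [-> + _|w0] := eqVneq w 0; first by rewrite addr0.
move=> /(_ z0) kz /(_ w0) kw zw0.
by apply: le_trans (place_valD v z0 w0 zw0); rewrite le_min kz kw.
Qed.

Lemma val_ge_sum k (I : Type) (r : seq I) (f : I -> K) :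
  (forall i, val_ge k (f i)) -> val_ge k (\sum_(i <- r) f i).
Proof.
move=> kf; apply: (big_ind (val_ge k)); [exact: val_ge0 | exact: val_geD |].
by move=> i _; exact: kf.
Qed.

Lemma val_geM k l z w : val_ge k z -> val_ge l w -> val_ge (k + l) (z * w).
Proof.
move=> kz lw; rewrite /val_ge mulf_eq0 negb_or => /andP[z0 w0].
by rewrite place_valM // lerD ?kz ?lw.
Qed.

Lemma val_geC c : val_ge 0 (ff_const K c).
Proof. by rewrite /val_ge fmorph_eq0 => c0; rewrite place_valC. Qed.

Lemma val_geX z i : val_ge 0 z -> val_ge 0 (z ^+ i).
Proof.
move=> z0; elim: i => [_|i IH]; first by rewrite expr0 val1.
by rewrite exprS; apply: (@val_geM 0 0).
Qed.

Lemma val_ge_not_pole z : ~ is_pole v z -> val_ge 0 z.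
Proof. by move=> np z0; rewrite leNgt; apply/negP => vz; apply: np. Qed.

(** [c] is the value of [f] exactly when [f - c] has valuation at least 1,
    valuations being integers. *)
Lemma has_valueE f c : has_value v f c <-> val_ge 1 (f - ff_const K c).
Proof. by []. Qed.

Lemma has_value_ge0 f c : has_value v f c -> val_ge 0 f.
Proof.
move=> fc; rewrite -(subrK (ff_const K c) f).
by apply: val_geD; [move=> /fc; exact: ltW | exact: val_geC].
Qed.

Lemma has_valueC c : has_value v (ff_const K c) c.
Proof. by apply/has_valueE; rewrite subrr; exact: val_ge0. Qed.

Lemma has_valueD f g c d :
  has_value v f c -> has_value v g d -> has_value v (f + g) (c + d).
Proof.
move=> fc gd; apply/has_valueE; rewrite rmorphD opprD addrACA.
exact: val_geD.
Qed.

Lemma has_valueM f g c d :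
  has_value v f c -> has_value v g d -> has_value v (f * g) (c * d).
Proof.
move=> fc gd; apply/has_valueE; rewrite rmorphM.
have -> : f * g - ff_const K c * ff_const K d =
    (f - ff_const K c) * g + ff_const K c * (g - ff_const K d) by ring.
apply: val_geD; first by rewrite -[1]addr0; apply: val_geM => //; exact: has_value_ge0 gd.
by rewrite -[1]add0r; apply: val_geM => //; exact: val_geC.
Qed.

Lemma has_valueX f c i : has_value v f c -> has_value v (f ^+ i) (c ^+ i).
Proof.
move=> fc; elim: i => [|i IH]; last by rewrite !exprS; exact: has_valueM.
by rewrite !expr0 -(rmorph1 (ff_const K)); exact: has_valueC.
Qed.

Lemma has_value_sum (I : Type) (r : seq I) (f : I -> K) (c : I -> F) :
  (forall i, has_value v (f i) (c i)) ->
  has_value v (\sum_(i <- r) f i) (\sum_(i <- r) c i).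
Proof.
move=> fc; elim/big_ind2: _ => [||i _]; [|by move=> *; exact: has_valueD|exact: fc].
by rewrite -(rmorph0 (ff_const K)); exact: has_valueC.
Qed.

End Values.

(** * The function spelled by a message *)

Section Varphi.
Variables (F : finFieldType) (C : cab_code F) (B : seq (nat * nat)).
Variable msg : (size B).-tuple F.

Definition msg_eval (p : F * F) : F :=
  \sum_(l < size B)
    tnth msg l * p.1 ^+ (nth (0%N, 0%N) B l).1 * p.2 ^+ (nth (0%N, 0%N) B l).2.

Lemma varphi_value p : p \in code_pts C ->
  has_value (code_place C p) (varphi C msg) (msg_eval p).
Proof.
move=> /code_placeP[_ _ hx hy]; apply: has_value_sum => l.
apply: has_valueM; last exact: has_valueX.
by apply: has_valueM; [exact: has_valueC | exact: has_valueX].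
Qed.

(** At infinity the pole orders of the monomials are prescribed; at any other
    place x and y have no pole, hence neither has a polynomial in them. *)
Lemma varphi_RR : ordered_basis C B ->
  RR_space (code_Pinf C) (code_m C) (varphi C msg).
Proof.
move=> [_ BP] f0; case: (code_PinfP C) => _ poleX poleY pole_mono.
(* x and y have a pole at infinity, so they are non-zero and their powers have
   a meaningful valuation. *)
have [x0 _] : is_pole (code_Pinf C) (ff_x (code_ff C)) by apply/poleX => z.
have [y0 _] : is_pole (code_Pinf C) (ff_y (code_ff C)) by apply/poleY => z.
split=> [|w wP].
  move: f0; apply: val_ge_sum => l; rewrite -mulrA -[- _]add0r.
  apply: val_geM; first exact: val_geC.
  case E: (nth _ B l) => [i j] /= _.
  have := BP i j; rewrite -E mem_nth // => /esym/andP[ij _].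
  by rewrite -[leRHS]opprK pole_mono; lia.
move: f0; apply: val_ge_sum => l.
apply: (@val_geM _ _ _ _ 0 0); first apply: (@val_geM _ _ _ _ 0 0); first exact: val_geC.
  by apply/val_geX/val_ge_not_pole => /poleX.
by apply/val_geX/val_ge_not_pole => /poleY.
Qed.

End Varphi.

(** * Results and costs of loops *)

Section Loops.
Variable F : finFieldType.

Lemma result_map (A B : Type) (f : A -> prog F B) s :
  result (map_prog f s) = [seq result (f x) | x <- s].
Proof. by elim: s => //= x s ->. Qed.

(** Each iteration also pays for pushing its output. *)
Lemma cost_map (A B : Type) (f : A -> prog F B) s c :
  (forall x, cost (f x) <= c)%N -> (cost (map_prog f s) <= size s * c.+1)%N.
Proof. by move=> fc; elim: s => //= x s IH; have := fc x; lia. Qed.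

Lemma result_fold (A S : Type) (f : S -> A -> prog F S) st s :
  result (fold_prog f st s) = foldl (fun st x => result (f st x)) st s.
Proof. by elim: s st => //= x s IH st; rewrite IH. Qed.

Lemma cost_fold (A : eqType) (S : Type) (f : S -> A -> prog F S) st s c :
  (forall st x, x \in s -> cost (f st x) <= c)%N ->
  (cost (fold_prog f st s) <= size s * c)%N.
Proof.
elim: s st => //= x s IH st fc.
have h1 : (cost (f st x) <= c)%N by apply: fc; rewrite mem_head.
have := IH (result (f st x)) (fun st y ys => fc st y (mem_behead (s := x :: s) ys)).
lia.
Qed.

(** Repeated keys do no harm when the inserted value depends on the key only,
    hence the function [g] of keys rather than of loop indices. *)
Lemma fold_insert (I K : eqType) (A : Type) (key : I -> K) (g : K -> A)
    (f : table K A -> I -> prog F (table K A)) t0 s :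
  (forall t x k, x \in s ->
    result (f t x) k = if k == key x then Some (g (key x)) else t k) ->
  forall k, result (fold_prog f t0 s) k =
    if k \in map key s then Some (g k) else t0 k.
Proof.
elim: s t0 => //= x s IH t0 fP k.
rewrite IH => [|t y k' ys]; last by rewrite fP // inE ys orbT.
by rewrite inE fP ?mem_head //; case: eqP => [->|_] //=; case: ifP.
Qed.

End Loops.

(** * Splitting a point set into fibres *)

Section SplitPoints.
Variable F : finFieldType.
Implicit Types (P : seq (F * F)) (x y : F).

Definition fiber P x : seq F := [seq p.2 | p <- P & p.1 == x].

Lemma mem_fiber P x y : (y \in fiber P x) = ((x, y) \in P).
Proof.
apply/mapP/idP => [[[x' y']]|xyP].
  by rewrite mem_filter /= => /andP[/eqP-> +] ->.
by exists (x, y) => //; rewrite mem_filter eqxx.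
Qed.

Lemma fiber_uniq P x : uniq P -> uniq (fiber P x).
Proof.
move=> uP; rewrite map_inj_in_uniq ?filter_uniq // => -[x1 y1] [x2 y2].
by rewrite !mem_filter /= => /andP[/eqP-> _] /andP[/eqP-> _] ->.
Qed.

(** The ordinates of a fibre are pushed one after the other, so they are listed
    in reverse order. *)
Lemma split_pointsP P (st := result (split_points P)) :
  [/\ uniq st.1, st.1 =i map fst P &
      forall x, st.2 x = if x \in map fst P then Some (rev (fiber P x)) else None].
Proof.
rewrite {}/st /split_points result_fold.
elim/last_ind: P => [|P p]; first by [].
rewrite foldl_rcons; case: (foldl _ _ P) => xs T /= [uxs xsP TP].
rewrite TP; case: ifP => pP /=; (split=> [|x|x] /=).
- by [].
- by rewrite xsP map_rcons mem_rcons inE; case: eqP => [->|].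
- rewrite map_rcons mem_rcons inE /fiber filter_rcons.
  rewrite [p.1 == x]eq_sym; case: eqP => [->|_] /=; last exact: TP.
  by rewrite map_rcons rev_rcons.
- by rewrite uxs xsP pP.
- by rewrite map_rcons mem_rcons !inE xsP.
- rewrite map_rcons mem_rcons inE /fiber filter_rcons.
  rewrite [p.1 == x]eq_sym; case: eqP => [->|_] /=; last exact: TP.
  rewrite map_rcons rev_rcons.
  have : ~~ has (fun q => q.1 == p.1) P.
    by apply: contraFN pP => /hasP[q qP /eqP<-]; rewrite map_f.
  by rewrite has_filter negbK => /eqP->.
Qed.

Lemma cost_split_points P : (cost (split_points P) <= size P * 4)%N.
Proof.
by apply: cost_fold => -[xs T] p _ /=; case: (T p.1) => [ys|].
Qed.

Lemma size_fiber P x : uniq P -> size (fiber P x) = #|Yset P x|.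
Proof.
move=> /(@fiber_uniq _ x)/card_uniqP<-.
by apply: eq_card => y; rewrite inE mem_fiber.
Qed.

Lemma size_split_points P : size (result (split_points P)).1 = #|Xset P|.
Proof.
have [/card_uniqP<- memP _] := split_pointsP P.
apply: eq_card => x; rewrite memP.
by apply/mapP/imsetP => -[p pP ->]; exists p.
Qed.

(** Each point is counted once, at its abscissa. *)
Lemma size_points P : uniq P -> size P = (\sum_(x in Xset P) #|Yset P x|)%N.
Proof.
move=> uP; rewrite -sum1_size.
under [RHS]eq_bigr => x _.
  rewrite -size_fiber // size_map -sum1_size big_filter big_mkcond.
  over.
rewrite exchange_big /= !big_seq; apply: eq_bigr => p pP.
rewrite -big_mkcondr (big_pred1 p.1) // => x /=.
rewrite eq_sym; case: eqP => [->|_]; rewrite ?andbF // andbT.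
by apply/imsetP; exists p.
Qed.

End SplitPoints.

(** * Bivariate multipoint evaluation *)

Lemma horner_Poly_mkseq (R : nzRingType) n (E : nat -> R) x :
  (Poly [seq E i | i <- iota 0 n]).[x] = \sum_(i < n) E i * x ^+ i.
Proof.
rewrite (@horner_coef_wide _ n); last first.
  by apply: leq_trans (size_Poly _) _; rewrite size_map size_iota.
by apply: eq_bigr => i _; rewrite coef_Poly (nth_mkseq _ E).
Qed.

Section BivariateMPE.
Variables (U : mpe_type) (F : finFieldType).
Hypothesis U_correct : forall (h : {poly F}) (S : seq F), uniq S ->
  forall x, x \in S -> result (@U F h S) x = Some h.[x].
Variable P : seq (F * F).
Hypothesis uP : uniq P.

(** The polynomial g_alpha has the coefficients f_i(alpha), so its value at beta
    is the sum of the f_i(alpha) beta^i, that is f(alpha, beta). *)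
Lemma BivariateMPE_correct f p : p \in P ->
  result (BivariateMPE U f P) p = Some f.[p.2%:P].[p.1].
Proof.
move=> pP; rewrite /BivariateMPE /=.
case: (split_pointsP P); case: (result (split_points P)) => xs T /= uxs xsP TP.
rewrite result_map.
rewrite (fold_insert (key := id) (g := fun p => f.[p.2%:P].[p.1])) ?map_id ?pP //.
move=> t {pP}[x y] k pP /=.
have xX : x \in map fst P by apply/mapP; exists (x, y).
rewrite (fold_insert (key := id) (g := fun x => result
  (@U F (Poly [seq odflt 0 (Fi x) | Fi <- [seq result (@U F f`_i xs) | i <- iota 0 (size f)]])
     (odflt [::] (T x))))) => [|t' x' k' _ /=]; last by rewrite result_map.
rewrite map_id xsP xX /= U_correct; last first.
- by rewrite TP xX mem_rev mem_fiber.
- by rewrite TP xX rev_uniq fiber_uniq.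
rewrite -map_comp horner_Poly_mkseq /= [f.[_]]horner_coef horner_sum.
case: eqP => // _; congr Some; apply: eq_bigr => i _.
by rewrite U_correct ?xsP // hornerM -rmorphXn hornerC.
Qed.

(** The function [u] bounds balanced evaluations, those whose polynomial has
    degree less than the number of points; under the size hypotheses on [f] and
    on the fibres, both rounds make only such calls. *)
Lemma cost_BivariateMPE (u : nat -> nat) (a : nat) (f : {poly {poly F}}) :
  (forall (h : {poly F}) (S : seq F), uniq S -> (0 < size S)%N ->
     (size h <= size S)%N -> (cost (@U F h S) <= u (size S))%N) ->
  (0 < a)%N -> (0 < size P)%N ->
  (size f <= a)%N -> (forall j, (size (f`_j)%R <= #|Xset P|)%N) ->
  (forall x, x \in Xset P -> #|Yset P x| = a) ->
  (cost (BivariateMPE U f P) <= 7 * size P + a * (u #|Xset P|).+1 +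
     #|Xset P| * (2 * a + 2 + u a))%N.
Proof.
move=> hu a0 P0 fa fX YP; rewrite /BivariateMPE /=.
have c1 := cost_split_points P.
have X0 : (0 < #|Xset P|)%N.
  case: P P0 => // p P' _; apply/card_gt0P; exists p.1.
  by apply/imsetP; exists p; rewrite ?mem_head.
have XE x : (x \in Xset P) = (x \in map fst P).
  by apply/imsetP/mapP => -[p pP ->]; exists p.
have sX := size_split_points P.
case: (split_pointsP P) => uxs xsP TP.
move: sX uxs xsP TP; case: (result (split_points P)) => xs T /= sX uxs xsP TP.
set Fs := map_prog _ _; set G := fold_prog _ _ xs; set V := fold_prog _ _ P.
(* First round: one evaluation on the abscissas for each power of Y. *)
have c2 : (cost Fs <= a * (u #|Xset P|).+1)%N.
  apply: leq_trans (_ : size (iota 0 (size f)) * (u #|Xset P|).+1 <= _)%N.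
    by apply: cost_map => i; rewrite -sX hu // sX ?X0.
  by rewrite size_iota leq_mul2r fa orbT.
have sF : (size (result Fs) <= a)%N by rewrite result_map size_map size_iota.
(* Second round: one evaluation on the fibre of each abscissa, after reading
   its coefficients off the tables of the first round. *)
have c3 : (cost G <= #|Xset P| * (2 * a + 2 + u a))%N.
  rewrite -sX; apply: cost_fold => t x xX /=.
  have xP : x \in map fst P by rewrite -xsP.
  set cs := map_prog _ _.
  have ccs : (cost cs <= size (result Fs) * 2)%N by apply: cost_map.
  have scs : (size (Poly (result cs)) <= a)%N.
    by apply: leq_trans (size_Poly _) _; rewrite result_map size_map.
  have sY : size (rev (fiber P x)) = a by rewrite size_rev size_fiber // YP // XE.
  have := hu (Poly (result cs)) (rev (fiber P x)).
  rewrite TP xP /= rev_uniq fiber_uniq // sY => /(_ isT a0 scs).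
  by move: ccs sF; lia.
have c4 : (cost V <= size P * 3)%N by apply: cost_fold.
apply: leq_trans (leq_add c1 (leq_add c2 (leq_add c3 c4))) _.
move: (size P) (a * _)%N (#|Xset P| * _)%N => n A B; lia.
Qed.

End BivariateMPE.

(** * The standard form of a message *)

Section StandardForm.
Variables (F : finFieldType) (a m : nat) (B : seq (nat * nat)).
Variable msg : (size B).-tuple F.
Hypothesis uB : uniq B.
Hypothesis inB : forall i j, (i, j) \in B -> ((i < (m %/ a).+1) && (j < a))%N.

Definition grid : seq (nat * nat) :=
  [seq (i, j) | j <- iota 0 a, i <- iota 0 (m %/ a).+1].

Lemma sub_grid : {subset B <= grid}.
Proof.
move=> [i j] /inB/andP[ia ja].
by apply/allpairsP; exists (j, i); rewrite !mem_iota.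
Qed.

Lemma grid_uniq : uniq grid.
Proof.
apply: allpairs_uniq; rewrite ?iota_uniq //.
by move=> [j i] [j' i'] _ _ [-> ->].
Qed.

Lemma size_basis : (size B <= a * (m %/ a).+1)%N.
Proof.
by rewrite -[leqRHS](_ : size grid = _) ?uniq_leq_size ?size_allpairs ?size_iota //;
  exact: sub_grid.
Qed.

(** The zeros outside of [B] are the default that the algorithm substitutes for
    absent table entries. *)
Definition msg_coef (k : nat * nat) : F :=
  if k \in B then nth 0 msg (index k B) else 0.

Lemma standard_formE : result (standard_form a m B msg) =
  Poly [seq Poly [seq msg_coef (i, j) | i <- iota 0 (m %/ a).+1] | j <- iota 0 a].
Proof.
rewrite /standard_form.
set T := fold_prog _ _ (iota 0 (size B)); cbn [result].
have TP k : odflt 0 (result T k) = msg_coef k.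
  rewrite /T /msg_coef (fold_insert (key := nth (0%N, 0%N) B)
    (g := fun k => nth 0 msg (index k B))) => [|t l k' /=].
    by rewrite -/(mkseq _ _) mkseq_nth; case: ifP.
  rewrite mem_iota => /andP[_ lB]; rewrite index_uniq //.
  by rewrite odflt_onth.
rewrite result_map; under eq_map => j.
  cbn [result]; rewrite result_map.
  rewrite (eq_map (g := fun i => msg_coef (i, j))) => [|i]; last exact: TP.
  over.
by [].
Qed.

(** The dense sum over the grid reduces to the exponents of [B], the other
    coefficients being zero. *)
Lemma standard_form_eval (x y : F) :
  (result (standard_form a m B msg)).[y%:P].[x] =
  \sum_(l < size B) tnth msg l * x ^+ (nth (0%N, 0%N) B l).1
                               * y ^+ (nth (0%N, 0%N) B l).2.
Proof.
rewrite standard_formE horner_Poly_mkseq horner_sum.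
under eq_bigr => j _.
  rewrite hornerM -rmorphXn hornerC horner_Poly_mkseq big_distrl /=.
  over.
rewrite -(big_mkord xpredT (fun j => \sum_(i < (m %/ a).+1)
  msg_coef (i : nat, j) * x ^+ i * y ^+ j)).
under eq_bigr => j _.
  rewrite -(big_mkord xpredT (fun i => msg_coef (i, j) * x ^+ i * y ^+ j)).
  over.
rewrite /= /index_iota !subn0.
transitivity (\sum_(k <- grid) msg_coef k * x ^+ k.1 * y ^+ k.2).
  by rewrite big_allpairs_dep.
transitivity (\sum_(k <- B) msg_coef k * x ^+ k.1 * y ^+ k.2).
  rewrite (bigID (mem B)) /= [X in _ + X]big1 ?addr0; last first.
    by move=> k /negPf kB; rewrite /msg_coef kB !mul0r.
  rewrite -big_filter; apply: perm_big; apply: uniq_perm => //.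
    by rewrite filter_uniq // grid_uniq.
  by move=> k; rewrite mem_filter; case: (boolP (k \in B)) => // /sub_grid.
rewrite (big_nth (0%N, 0%N)) big_mkord; apply: eq_bigr => l _.
by rewrite /msg_coef mem_nth // index_uniq // (tnth_nth 0).
Qed.

Lemma size_standard_form : (size (result (standard_form a m B msg)) <= a)%N.
Proof.
by rewrite standard_formE (leq_trans (size_Poly _)) // size_map size_iota.
Qed.

Lemma size_standard_form_coef j :
  (size ((result (standard_form a m B msg))`_j)%R <= (m %/ a).+1)%N.
Proof.
rewrite standard_formE coef_Poly.
have [ja|ja] := ltnP j a; last by rewrite nth_default ?size_map ?size_iota ?size_poly0.
rewrite (nth_map 0%N) ?size_iota //.
by rewrite (leq_trans (size_Poly _)) // size_map size_iota.
Qed.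

Lemma cost_standard_form :
  (cost (standard_form a m B msg) <= 4 * (a * (m %/ a).+1) + a)%N.
Proof.
rewrite /standard_form; set T := fold_prog _ _ _; cbn [cost].
set rows := map_prog _ _.
have c1 : (cost T <= size (iota 0 (size B)) * 2)%N by apply: cost_fold.
have c2 : (cost rows <= size (iota 0 a) * ((m %/ a).+1 * 2).+1)%N.
  apply: cost_map => j; cbn [cost]; rewrite addn0.
  by rewrite -[X in (_ <= X * _)%N](size_iota 0); apply: cost_map.
have := size_basis; move: c1 c2; rewrite !size_iota addn0.
rewrite [(a * (_ * 2).+1)%N]mulnS mulnA.
by move: (a * _.+1)%N (cost T) (cost rows) => *; lia.
Qed.

End StandardForm.

(** * Encoding *)

Section Encode.
Variables (U : mpe_type) (F : finFieldType).
Hypothesis U_correct : forall (h : {poly F}) (S : seq F), uniq S ->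
  forall x, x \in S -> result (@U F h S) x = Some h.[x].
Variables (C : cab_code F) (B : seq (nat * nat)) (msg : (size B).-tuple F).
Hypothesis CB : ordered_basis C B.

Lemma code_a_gt0 : (0 < code_a C)%N.
Proof. by case: (code_Cab C) => -[]. Qed.

Lemma basis_bound i j : (i, j) \in B ->
  ((i < (code_m C %/ code_a C).+1) && (j < code_a C))%N.
Proof.
have a0 := code_a_gt0; rewrite CB.2 => /andP[ij ja].
rewrite ltnS leq_divRL //; apply/andP; split; last by move: a0 ja; lia.
by move: ij; rewrite mulnC; lia.
Qed.

Lemma EncodeE : result (Encode U C B msg) = map (msg_eval msg) (code_pts C).
Proof.
rewrite /Encode; cbn [result]; rewrite result_map.
apply/eq_in_map => p pP; rewrite /get_or0; cbn [result].
rewrite BivariateMPE_correct ?code_uniq //; cbn [odflt oapp].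
by rewrite standard_form_eval ?CB.1 //; exact: basis_bound.
Qed.

Lemma Encode_ev : is_ev (varphi C msg) (result (Encode U C B msg)).
Proof.
rewrite EncodeE; split=> [|i iC]; first by rewrite size_map.
rewrite (nth_map (0, 0)) //; apply: varphi_value.
exact: mem_nth.
Qed.

Hypothesis mC : maximal_semi_grid C.

(** The fibre of a point's abscissa is not empty, so that the semi-grid condition
    gives it the maximal cardinal, which is a. *)
Lemma length_semi_grid :
  code_length C = (code_a C * #|Xset (code_pts C)|)%N /\
  forall x, x \in Xset (code_pts C) -> #|Yset (code_pts C) x| = code_a C.
Proof.
case: mC => sg nu _.
have YP x : x \in Xset (code_pts C) -> #|Yset (code_pts C) x| = code_a C.
  move=> /imsetP[[x' y] pP ->]; rewrite -nu; case: (sg x') => // /cards0_eq/setP/(_ y).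
  by rewrite !inE pP.
split=> //; rewrite /code_length size_points ?code_uniq // (eq_bigr _ YP).
by rewrite sum_nat_const mulnC.
Qed.

(** The balance of the calls comes from n = a s and m < n, whence m / a < s.
    The 19 n instructions outside of the evaluations split as follows: at most
    5 n for the standard form, 7 n for splitting the points and collecting the
    results, n for listing the tables of the first round, 4 n for assembling
    the polynomials of the second round, and 2 n for the output. *)
Lemma cost_Encode (u : nat -> nat) (n := code_length C) (a := code_a C)
    (s := #|Xset (code_pts C)|) :
  (forall (h : {poly F}) (S : seq F), uniq S -> (0 < size S)%N ->
     (size h <= size S)%N -> (cost (@U F h S) <= u (size S))%N) ->
  (cost (Encode U C B msg) <= 19 * n + a * u s + s * u a)%N.
Proof.
move=> hu; have [nE YP] := length_semi_grid; have a0 := code_a_gt0.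
have mn : (code_m C < n)%N by case: mC.
have ms : ((code_m C %/ a).+1 <= s)%N by rewrite ltn_divLR // mulnC -nE.
have bb := basis_bound.
rewrite /Encode; cbn [cost].
have c1 := cost_standard_form msg CB.1 bb.
set f := result (standard_form _ _ _ _).
have c2 : (cost (BivariateMPE U f (code_pts C)) <= 7 * n + a * (u s).+1 +
   s * (2 * a + 2 + u a))%N.
  apply: cost_BivariateMPE => //; first exact: code_uniq.
  - by apply: leq_ltn_trans mn.
  - exact: size_standard_form CB.1.
  - by move=> j; apply: leq_trans ms; exact: size_standard_form_coef CB.1 j.
set E := map_prog _ _.
have c3 : (cost E <= n * 2)%N by apply: cost_map.
apply: leq_trans (leq_add c1 (leq_add c2 c3)) _.
have s0 : (0 < s)%N by apply: leq_trans ms.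
have nE' : n = (a * s)%N by [].
have h1 : (a <= n)%N by rewrite nE' leq_pmulr.
have h2 : (s <= n)%N by rewrite nE' leq_pmull.
have h3 : (a * (code_m C %/ a).+1 <= n)%N by rewrite nE' leq_mul2l ms orbT.
have h4 : (s * (2 * a + 2 + u a) = 2 * n + 2 * s + s * u a)%N by rewrite nE'; ring.
rewrite -/a h4 [(a * (u s).+1)%N]mulnSr.
move: (a * (_ %/ _).+1)%N (a * u s)%N (s * u a)%N h1 h2 h3; clear.
by move: n a s => n a s A A' A'' h1 h2 h3; lia.
Qed.

End Encode.

(** * Multiplication times *)

Section MultiplicationTime.
Variables (R : realType) (M : nat -> nat).
Hypothesis M_gt0 : forall n, (0 < n)%N -> (0 < M n)%N.
Hypothesis M_superadd :
  forall s t, (0 < s)%N -> (0 < t)%N -> (M s + M t <= M (s + t))%N.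

Lemma M_mono s t : (0 < s)%N -> (s <= t)%N -> (M s <= M t)%N.
Proof.
move=> s0; rewrite leq_eqVlt => /predU1P[->//|st].
have := M_superadd s0 (t := t - s); rewrite subn_gt0 subnKC ?(ltnW st) // => /(_ st).
exact: leq_trans (leq_addr _ _).
Qed.

Lemma M_mul a s : (0 < a)%N -> (0 < s)%N -> (a * M s <= M (a * s))%N.
Proof.
move=> + s0; elim: a => // -[|a] IH _; first by rewrite !mul1n.
rewrite mulSn [(_.+2 * s)%N]mulSn.
apply: leq_trans (_ : M s + M (a.+1 * s) <= _)%N; first by rewrite leq_add2l IH.
by apply: M_superadd; rewrite ?muln_gt0.
Qed.

Lemma leq_M n : (0 < n)%N -> (n <= M n)%N.
Proof.
move=> n0; have := M_mul n0 (ltn0Sn 0); rewrite muln1; apply: leq_trans.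
by rewrite leq_pmulr // M_gt0.
Qed.

Lemma bigO_nearP (f g : nat -> R) : f =O_\oo g <->
  exists2 k : R, 0 < k & \forall n \near \oo, `|f n| <= k * `|g n|.
Proof. exact: (eqO_exP (V := R^o) (W := R^o)). Qed.

Lemma ln_nat_ge0 n : 0 <= ln (n%:R : R).
Proof. by case: n => [|n]; [rewrite ln0 | rewrite ln_ge0 // ler1n]. Qed.

Lemma ler_ln_nat m n : (0 < m)%N -> (m <= n)%N -> ln (m%:R : R) <= ln n%:R.
Proof.
move=> m0 mn; rewrite ler_ln ?ler_nat // posrE ltr0n //.
exact: leq_trans mn.
Qed.

Lemma ln_nat_near : \forall n \near \oo, 1 <= ln (n%:R : R).
Proof.
have := nbhs_infty_ger (expR 1 : R); apply: filterS => n en.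
by rewrite -[leLHS]expRK ler_ln ?posrE ?expR_gt0 // (lt_le_trans (expR_gt0 _) en).
Qed.

(** An asymptotic bound holds everywhere once a constant absorbs the finitely
    many exceptions; the cost estimate needs this, since a long code may call
    univariate evaluation on few points. *)
Lemma MlogO_bound (T : nat -> R) : MlogO M T ->
  exists2 c : R, 0 <= c & forall n, T n <= c * ((M n)%:R * ln n%:R + 1).
Proof.
move=> /bigO_nearP[c c0 [N _ TN]].
exists (c + \sum_(i < N) `|T i|) => [|n].
  by rewrite addr_ge0 ?(ltW c0) // sumr_ge0.
have g0 : 0 <= (M n)%:R * ln (n%:R : R) by rewrite mulr_ge0 ?ln_nat_ge0.
have S0 : 0 <= \sum_(i < N) `|T i| by rewrite sumr_ge0.
have [Nn|nN] := leqP N n.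
  apply: le_trans (ler_norm _) (le_trans (TN n Nn) _).
  by rewrite (ger0_norm g0); nra.
have Tn : `|T n| <= \sum_(i < N) `|T i|.
  by rewrite (bigD1 (Ordinal nN)) //= lerDl sumr_ge0.
have := ler_norm (T n); nra.
Qed.

Variable D : nat.
Hypothesis M_double : forall n, (0 < n)%N -> (M (2 * n) <= D * M n)%N.

(** The bound for a balanced call on [s] points: its degree and its number of
    points add up to at most 2 s, and [D] is the doubling constant of [M]. *)
Definition call_bound (c : R) (s : nat) : R :=
  c * ((D * M s)%:R * ln (2 * s)%:R + 1).

Lemma call_boundP (c : R) (T : nat -> R) k s :
  0 <= c -> (forall n, T n <= c * ((M n)%:R * ln n%:R + 1)) ->
  (0 < k)%N -> (k <= 2 * s)%N -> T k <= call_bound c s.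
Proof.
move=> c0 TP k0 ks; apply: le_trans (TP k) _; apply: ler_wpM2l => //.
rewrite lerD2r ler_pM ?ln_nat_ge0 ?ler_ln_nat // ler_nat.
apply: leq_trans (M_mono k0 ks) (M_double _).
by case: s ks k0; lia.
Qed.

(** By superadditivity, [a] evaluations on [s] points cost no more than the bound
    for one on [a * s] points, except that the additive constant is paid
    [a <= a * s] times. *)
Lemma call_bound_mul (c : R) a s : 0 <= c -> (0 < a)%N -> (0 < s)%N ->
  a%:R * call_bound c s <=
  c * ((D * M (a * s))%:R * ln (2 * (a * s))%:R + (a * s)%:R).
Proof.
move=> c0 a0 s0; rewrite /call_bound mulrCA; apply: ler_wpM2l => //.
rewrite mulrDr mulr1 mulrA -natrM; apply: lerD; last by rewrite ler_nat leq_pmulr.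
apply: ler_pM; rewrite ?ln_nat_ge0 //.
  by rewrite ler_nat mulnCA leq_mul2l M_mul ?orbT.
by apply: ler_ln_nat; rewrite ?muln_gt0 // leq_mul2l leq_pmull ?orbT.
Qed.

(** Linear overhead plus the two rounds of evaluations, each of them bounded as
    in [call_bound_mul]. *)
Definition encode_bound (c : R) (n : nat) : R :=
  19 * n%:R + 2 * (c * ((D * M n)%:R * ln (2 * n)%:R + n%:R)).

(** The linear terms are absorbed because n <= M(n), and log(2n) <= 2 log n once
    n >= 2. *)
Lemma encode_bound_MlogO c : 0 <= c -> MlogO M (encode_bound c).
Proof.
move=> c0; apply/bigO_nearP; exists (19 + 2 * c + 4 * c * D%:R).
  by rewrite ltr_pwDl ?mulr_ge0 //; lra.
apply: filterS (filterI ln_nat_near (nbhs_infty_ge 2)) => n [L1 n2].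
have n0 : (0 < n)%N by apply: leq_trans n2.
have nM : n%:R <= (M n)%:R :> R by rewrite ler_nat leq_M.
have L2 : ln (2 * n)%:R <= 2 * ln n%:R :> R.
  rewrite natrM lnM ?posrE ?ltr0n //.
  by have := ler_ln_nat (ltn0Sn 1) n2; lra.
have L2_ge0 := ln_nat_ge0 (2 * n).
have n_ge0 : 0 <= n%:R :> R by [].
have g0 : 0 <= (M n)%:R * ln n%:R :> R by rewrite mulr_ge0 ?ln_nat_ge0.
have e0 : 0 <= encode_bound c n.
  rewrite /encode_bound addr_ge0 // mulr_ge0 // mulr_ge0 // addr_ge0 //.
  by rewrite mulr_ge0.
rewrite (ger0_norm e0) (ger0_norm g0) /encode_bound (natrM _ D).
set L := ln n%:R in L1 L2 *; set m := (M n)%:R in nM *; set d := D%:R.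
(* Here log n >= 1. *)
have h : n%:R <= m * L by nra.
have d0 : 0 <= d by [].
have h2 : d * m * ln (2 * n)%:R <= 2 * (d * (m * L)).
  apply: le_trans (ler_wpM2l _ L2) _; first by rewrite mulr_ge0.
  by lra.
have h3 := ler_wpM2l c0 (lerD h2 h).
lra.
Qed.

(** The exponent 3 collects log n, log n and log log n <= log n. *)
Lemma MlogO_softO :
  (fun n : nat => (M n)%:R : R) =O_\oo
    (fun n : nat => n%:R * ln (n%:R : R) * ln (ln (n%:R : R)) : R) ->
  @MlogO R M `<=` softO (fun n : nat => n%:R : R).
Proof.
move=> /bigO_nearP[k k0 Mk] f /bigO_nearP[l l0 fl].
exists 3%N; apply/bigO_nearP; exists (l * k); first exact: mulr_gt0.
apply: filterS (filterI ln_nat_near (filterI Mk fl)) => n [L1 [Mn fn]].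
apply: le_trans fn _; cbv beta; rewrite -(mulrA l) ler_pM2l // normrM.
move: Mn L1; set L := ln n%:R => Mn L1.
have L0 : 0 <= L by apply: le_trans L1.
apply: le_trans (ler_wpM2r _ Mn) _ => //.
rewrite -(mulrA k) ler_pM2l // (normrM (n%:R * L)) !(normrM n%:R) normrX (ger0_norm L0).
have lnL : `|ln L| <= L.
  by rewrite ger0_norm ?ln_ge0 // ltW // ln_sublinear // (lt_le_trans ltr01).
rewrite -!mulrA ler_wpM2l //.
have -> : L ^+ 3 = L * (L * L) by ring.
by rewrite ler_wpM2l // ler_wpM2r.
Qed.

End MultiplicationTime.

Unset Implicit Arguments.

(** * Complexity of encoding *)

Theorem propositionV2 (R : realType)
    (PolyMul : forall F : finFieldType, {poly F} -> {poly F} -> prog F {poly F})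
    (M : nat -> nat) (UnivariateMPE : mpe_type)
    (hM : multiplication_time PolyMul M)
    (hMPE : fast_mpe R M UnivariateMPE) :
  (exists2 T : nat -> R, MlogO M T &
     forall (F : finFieldType) (C : cab_code F), maximal_semi_grid C ->
     forall B : seq (nat * nat), ordered_basis C B ->
     forall msg : (size B).-tuple F,
       [/\ is_ev (varphi C msg) (result (Encode UnivariateMPE C B msg)),
           codeword C (result (Encode UnivariateMPE C B msg))
         & (cost (Encode UnivariateMPE C B msg))%:R <= T (code_length C)])
  /\
  ((fun n : nat => (M n)%:R : R) =O_\oo
     (fun n : nat => n%:R * ln (n%:R : R) * ln (ln (n%:R : R)) : R) ->
   (@MlogO R M `<=` softO (fun n : nat => n%:R : R))).
Proof.
case: hM => _ M_gt0 M_superadd [D M_double].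
case: hMPE => U_correct [T TO U_cost]; split; last exact: MlogO_softO.
have [c c0 Tc] := MlogO_bound TO.
exists (encode_bound M D c); first exact: encode_bound_MlogO.
move=> F C mC B CB msg.
have ev := Encode_ev (U_correct F) msg CB.
split=> //; first by exists (varphi C msg) => //; exact: varphi_RR.
(* Costs are natural numbers, so the real bound on a call can be truncated. *)
pose u s := Num.truncn (call_bound M D c s).
have ge0 s : 0 <= call_bound M D c s.
  by rewrite mulr_ge0 // addr_ge0 // mulr_ge0 // ln_nat_ge0.
have hu (h : {poly F}) (S : seq F) : uniq S -> (0 < size S)%N ->
    (size h <= size S)%N -> (cost (UnivariateMPE F h S) <= u (size S))%N.
  move=> uS S0 hS; rewrite truncn_ge_nat //.
  apply: le_trans (U_cost F h S uS) _.
  apply: call_boundP => //; first by rewrite addn_gt0 S0 orbT.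
  by rewrite mul2n -addnn leq_add2r (leq_trans (leq_pred _)).
have a0 := code_a_gt0 C.
have [nE _] := length_semi_grid mC.
set a := code_a C in a0 nE; set s := #|Xset (code_pts C)| in nE.
have s0 : (0 < s)%N.
  by case: mC => _ _ /(leq_ltn_trans (leq0n _)); rewrite nE muln_gt0 => /andP[].
have Eu := cost_Encode msg CB mC hu.
have uP k : (u k)%:R <= call_bound M D c k by rewrite truncn_le.
have h1 := call_bound_mul M_superadd D c0 a0 s0.
have h2 := call_bound_mul M_superadd D c0 s0 a0.
rewrite -nE in h1; rewrite [(s * a)%N]mulnC -nE in h2.
apply: le_trans (_ : (19 * code_length C + a * u s + s * u a)%:R <= _).
  by rewrite ler_nat.
have h3 := ler_wpM2l (ler0n R a) (uP s).
have h4 := ler_wpM2l (ler0n R s) (uP a).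
rewrite /encode_bound 2!natrD (natrM _ 19) (natrM _ a) (natrM _ s); lra.
Qed.
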